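(* Let $p,\delta\in(0,1)$ and $C>0$ be fixed constants, and let $\{G_n\}_{n\in\mathbb{N}}$ be a sequence of graphs, $G_n$ having vertex set $[n]$, such that $$\max_{v\in[n]}\bigl||N_v|-np\bigr|<Cn^{\delta}\qquad\text{and}\qquad \max_{v\neq v'\in[n]}\bigl||N_v\cap N_{v'}|-np^2\bigr|<Cn^{\delta}.$$ Then there exists a positive constant $C_0'$, depending on $p$, such that $$\max_{s\le \left((1-\delta)\wedge\frac12\right)\frac{\log n}{\log\gamma_p}-C_0'\log\log n}\ \max_{H_s\in\mathcal{G}(s)}\left|\frac{n_{G_n}(H_s)}{\frac{(n)_s}{|\mathrm{Aut}(H_s)|}\left(\frac{p}{1-p}\right)^{|E(H_s)|}(1-p)^{\binom{s}{2}}}-1\right|\longrightarrow 0$$ as $n\to\infty$.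
   Context: $[n]=\{1,\dots,n\}$; graphs are simple and undirected. For a vertex $v$ of $G_n$, $N_v=\{u\in[n]:u\sim v\}$ is its set of neighbours in $G_n$. $\mathcal{G}(s)$ is the collection of all graphs with vertex set $[s]$ ($s$ a positive integer). For a graph $H$, $n_{G_n}(H)$ is the number of induced isomorphic copies of $H$ in $G_n$ (i.e. the number of vertex subsets of $[n]$ whose induced subgraph in $G_n$ is isomorphic to $H$), $E(H)$ is the edge set of $H$, and $\mathrm{Aut}(H)$ its automorphism group. $\gamma_p=\max\{p^{-1},(1-p)^{-1}\}$, $(n)_s=n(n-1)\cdots(n-s+1)$, $a\wedge b=\min\{a,b\}$, and $\log$ is the natural logarithm. *)

(* Defs.v *)
From HB Require Import structures.
From mathcomp Require Import all_boot all_order all_algebra all_fingroup.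
From mathcomp Require Import all_classical all_reals all_analysis.
Set Implicit Arguments.
Unset Strict Implicit.
Unset Printing Implicit Defensive.
Import Order.TTheory GRing.Theory Num.Theory.
Import numFieldNormedType.Exports.
Local Open Scope ring_scope.

Record sgraph (T : finType) := SGraph {
  edges : {set {set T}};
  _ : [forall e in edges, #|e| == 2%N]
}.
HB.instance Definition _ (T : finType) := [isSub for @edges T].
HB.instance Definition _ (T : finType) := [Choice of sgraph T by <:].
HB.instance Definition _ (T : finType) := [Countable of sgraph T by <:].
HB.instance Definition _ (T : finType) := [Finite of sgraph T by <:].

Lemma card_edge (T : finType) (G : sgraph T) (e : {set T}) :
  e \in edges G -> #|e| = 2%N.
Proof. by case: G => E /= /forall_inP hE /hE /eqP. Qed.

(* Never holds for x = y, since then [set x; y] has only one element. *)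
Definition adj (T : finType) (G : sgraph T) : rel T :=
  fun x y => [set x; y] \in edges G.

Definition neighbours (T : finType) (G : sgraph T) (v : T) : {set T} :=
  [set u | adj G u v].

Definition is_iso (T U : finType) (H : sgraph T) (G : sgraph U) (f : T -> U) :
    Prop :=
  bijective f /\ forall x y, adj G (f x) (f y) = adj H x y.

Definition isomorphic (T U : finType) (H : sgraph T) (G : sgraph U) : Prop :=
  exists f : T -> U, is_iso H G f.

Definition aut_set (T : finType) (H : sgraph T) : {set {perm T}} :=
  [set s : {perm T} | `[< is_iso H H s >]].

Definition induced_edges (T : finType) (G : sgraph T) (S : {set T}) :
    {set {set {x : T | x \in S}}} :=
  [set e : {set {x : T | x \in S}} | [set val x | x in e] \in edges G].

Lemma induced_subproof (T : finType) (G : sgraph T) (S : {set T}) :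
  [forall e in induced_edges G S, #|e| == 2%N].
Proof.
apply/forall_inP => e; rewrite inE => /card_edge.
by rewrite card_imset; [move=> -> | exact: val_inj].
Qed.

Definition induced (T : finType) (G : sgraph T) (S : {set T}) :
    sgraph {x : T | x \in S} :=
  SGraph (induced_subproof G S).

Definition induced_copies (T U : finType) (G : sgraph T) (H : sgraph U) : nat :=
  #|[set S : {set T} | `[< isomorphic H (induced G S) >]]|.

Definition gamma (R : realType) (p : R) : R := Num.max p^-1 (1 - p)^-1.

Definition expected_copies (R : realType) (p : R) (n s : nat) (H : sgraph 'I_s) :
    R :=
  (n ^_ s)%:R / #|aut_set H|%:R * (p / (1 - p)) ^+ #|edges H|
    * (1 - p) ^+ 'C(s, 2).

Definition size_bound (R : realType) (p delta C0 : R) (n : nat) : R :=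
  Num.min (1 - delta) (1 / 2) * (ln n%:R / ln (gamma p)) - C0 * ln (ln n%:R).

(* The positive integers s <= x are exactly those with 1 <= s <= truncn x
   (truncn x is 0 when x < 0).  The quantities under the maxima are nonnegative,
   so the default value 0 only matters when no admissible s exists, which can
   only happen for finitely many n. *)
Definition max_relative_error (R : realType) (p delta C0 : R)
    (G : forall n : nat, sgraph 'I_n) (n : nat) : R :=
  \big[Num.max/0]_(1 <= s < (Num.truncn (size_bound p delta C0 n)).+1)
    \big[Num.max/0]_(H : sgraph 'I_s)
      `|(induced_copies (G n) H)%:R / expected_copies p n H - 1|.

(* Main.v *)
Require Import Defs.
From HB Require Import structures.
From mathcomp Require Import all_boot all_order all_algebra all_fingroup.
From mathcomp Require Import all_classical all_reals all_analysis.
From mathcomp Require Import ring lra.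
Set Implicit Arguments.
Unset Strict Implicit.
Unset Printing Implicit Defensive.
Import Order.TTheory GRing.Theory Num.Theory.
Import numFieldNormedType.Exports.
Local Open Scope ring_scope.

(** The proof embeds [H] into [G n] one vertex at a time and follows, for each
    vertex of [H] not yet embedded, the set of its remaining candidates. If the
    graph behaved like a random one, fixing one more vertex would shrink such a
    set by the factor [p] or [1 - p], according to the adjacency wanted, and the
    number of embeddings would be [n ^ s] times the product of these factors.
    Dividing by the number of automorphisms turns embeddings into induced copies
    ([induced_copies_aut], [card_embeddings_ext], [weight_pattern]).

    The degree and codegree hypotheses say that the columns of the centred
    adjacency matrix are almost orthogonal. Hence, for every set [T], the sum
    over all vertices [v] of the squared deviation of the degree of [v] into [T]
    from its expected value is at most [4 n |T| + 6 D |T| ^ 2], with [D] the error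
    in the hypotheses ([codegree_variance]). By Chebyshev's inequality at most
    [(4 n / |T| + 6 D) / e ^ 2] vertices deviate by [e |T|] or more
    ([few_rich], [few_poor]).

    Let [rho = min p (1 - p) = 1 / gamma]. All expected candidate sets have at
    least [n rho ^ s] elements, so up to powers of [ln n] there are at most
    [rho ^ - s + n ^ delta] bad vertices at each step. The size bound on [s]
    makes this smaller than [n rho ^ s] by a power of [ln n]: the exponent [1 / 2]
    serves for the first term and the exponent [1 - delta] for the second. This
    is what is needed for the lower bound, in which bad vertices are avoided
    ([ext_ge]), and also for the upper bound, in which a bad vertex may fail to
    shrink any of the remaining candidate sets ([ext_le]): a bad vertex at step
    [r] costs a factor of at most [rho ^ -(s - r)], but it is one of a candidate set of
    expected size at least [n rho ^ r], so that the comparison is again with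
    [n rho ^ s].

    The deviation allowed at each step is [(ln n) ^ -3]. It is compounded at most
    [s ^ 2] times, up to lower order terms, which is of order [(ln n) ^ 2]; the
    total relative error is therefore of order [1 / ln n]
    ([relative_error_le], [relative_error_asymp]). *)

(** * Induced copies and embeddings *)

Lemma adjC (T : finType) (G : sgraph T) (x y : T) : adj G x y = adj G y x.
Proof. by rewrite /adj finset.setUC. Qed.

Lemma adjxx (T : finType) (G : sgraph T) (x : T) : adj G x x = false.
Proof. by apply/negP => /card_edge; rewrite finset.setUid cards1. Qed.

Definition embeddings (T U : finType) (G : sgraph T) (H : sgraph U) :
    {set {ffun U -> T}} :=
  [set f : {ffun U -> T} | injectiveb f &&
     [forall x, [forall y, adj G (f x) (f y) == adj H x y]]].

Lemma embeddingsP (T U : finType) (G : sgraph T) (H : sgraph U)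
    (f : {ffun U -> T}) :
  reflect (injective f /\ forall x y, adj G (f x) (f y) = adj H x y)
          (f \in embeddings G H).
Proof.
rewrite inE; apply: (iffP andP) => -[].
  move=> /injectiveP fI /forallP h; split=> // x y.
  by have /forallP/(_ y)/eqP := h x.
move=> fI h; split; first exact/injectiveP.
by apply/forallP => x; apply/forallP => y; rewrite h.
Qed.

Lemma adj_induced (T : finType) (G : sgraph T) (S : {set T})
    (x y : {x : T | x \in S}) :
  adj (Defs.induced G S) x y = adj G (val x) (val y).
Proof. by rewrite /adj /= inE imsetU !imset_set1. Qed.

Lemma isomorphic_induced (T U : finType) (G : sgraph T) (H : sgraph U)
    (S : {set T}) :
  isomorphic H (Defs.induced G S) <->
  exists2 f : {ffun U -> T}, f \in embeddings G H & f @: [set: U] = S.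
Proof.
split=> [[f [[g fK gK] fA]]|[f /embeddingsP[fI fA] fS]].
  exists [ffun x => val (f x)].
    apply/embeddingsP; split=> [x y|x y]; rewrite !ffunE.
      by move=> /val_inj /(can_inj fK).
    by rewrite -adj_induced fA.
  apply/setP => x; apply/imsetP/idP => [[y _ ->]|xS].
    by rewrite ffunE (valP (f y)).
  by exists (g (Sub x xS)); rewrite ?finset.in_setT// ffunE gK SubK.
have fin x : f x \in S by rewrite -fS imset_f.
pose h x : {x : T | x \in S} := Sub (f x) (fin x).
have hI : injective h by move=> x y /(congr1 val); rewrite !SubK => /fI.
exists h; split; last by move=> x y; rewrite adj_induced !SubK fA.
apply: inj_card_bij => //.
by rewrite card_sig -[leqRHS]cardsT -(card_imset _ fI) fS.
Qed.

(** The automorphisms of [H] act freely and transitively, by precomposition, on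
    the embeddings with a given image. *)
Lemma card_embeddings_fiber (T U : finType) (G : sgraph T) (H : sgraph U)
    (f0 : {ffun U -> T}) :
  f0 \in embeddings G H ->
  #|[set f in embeddings G H | f @: [set: U] == f0 @: [set: U]]| = #|aut_set H|.
Proof.
move=> /embeddingsP[f0I f0A].
pose F (s : {perm U}) : {ffun U -> T} := [ffun x => f0 (s x)].
rewrite -(card_imset (aut_set H) (f := F)); last first.
  by move=> s t /ffunP st; apply/permP => x; have := st x; rewrite !ffunE => /f0I.
apply: eq_card => f; apply/idP/imsetP.
  rewrite inE => /andP[/embeddingsP[fI fA] /eqP fS].
  have fin x : exists y, f0 y == f x.
    have : f x \in f0 @: [set: U] by rewrite -fS imset_f.
    by move=> /imsetP[y _ ->]; exists y.
  (* The permutation carrying [f0] to [f] sends [x] to the preimage of [f x]. *)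
  pose g x := xchoose (fin x).
  have gP x : f0 (g x) = f x by apply/eqP/(xchooseP (fin x)).
  have gI : injective g by move=> x y /(congr1 f0); rewrite !gP => /fI.
  exists (perm gI); last by apply/ffunP => x; rewrite ffunE permE gP.
  rewrite inE; apply/asboolP; split; first by exists (perm gI)^-1%g; [exact: permK|exact: permKV].
  by move=> x y; rewrite !permE -f0A !gP fA.
move=> [s sH ->]; have /asboolP[_ sA] : `[< is_iso H H s >] by rewrite inE in sH.
rewrite inE; apply/andP; split.
  apply/embeddingsP; split=> [x y|x y]; rewrite !ffunE.
    by move=> /f0I /perm_inj.
  by rewrite f0A sA.
apply/eqP/setP => y; apply/imsetP/imsetP => -[x _ ->].
  by exists (s x); rewrite ?ffunE.
by exists ((s^-1)%g x); rewrite // ffunE permKV.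
Qed.

Lemma induced_copies_aut (T U : finType) (G : sgraph T) (H : sgraph U) :
  (induced_copies G H * #|aut_set H|)%N = #|embeddings G H|.
Proof.
rewrite -[RHS]sum1_card (partition_big (fun f : {ffun U -> T} => f @: [set: U])
  (mem [set S : {set T} | `[< isomorphic H (Defs.induced G S) >]])) /=; last first.
  by move=> f fE; rewrite inE; apply/asboolP/isomorphic_induced; exists f.
rewrite /induced_copies -sum_nat_const; apply: eq_bigr => S.
rewrite inE => /asboolP/isomorphic_induced[f0 f0E <-].
rewrite -(card_embeddings_fiber f0E) -sum1_card.
by apply: eq_bigl => f; rewrite inE.
Qed.

(** * Counting embeddings one vertex at a time *)

(** Excluding [v] itself makes the maps counted below injective. *)
Definition nbh (V : finType) (A : rel V) (b : bool) (v : V) : {set V} :=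
  [set u | (u != v) && (A v u == b)].

(** This is the number of extensions of a partial embedding, given only through
    the candidate sets [T j] that it leaves for the [k] remaining vertices; this
    form is what the inductive bounds need ([extE] gives the global meaning).
    Patterns and candidates are indexed by [nat] so that the recursion can shift
    them. *)
Fixpoint ext (V : finType) (A : rel V) (k : nat) (c : nat -> nat -> bool)
    (T : nat -> {set V}) : nat :=
  if k is k'.+1 then
    \sum_(v in T 0%N) ext A k' (fun i j => c i.+1 j.+1)
                        (fun j => T j.+1 :&: nbh A (c 0%N j.+1) v)
  else 1.

Lemma extE (V : finType) (A : rel V) (k : nat) (c : nat -> nat -> bool)
    (T : nat -> {set V}) :
  ext A k c T =
  #|[set f : {ffun 'I_k -> V} | [forall j : 'I_k, f j \in T j] &&
     [forall i : 'I_k, [forall j : 'I_k,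
        (i < j)%N ==> (f j \in nbh A (c i j) (f i))]]]|.
Proof.
elim: k c T => [|k IHk] c T /=.
  rewrite (_ : [set f | _] = [set: {ffun 'I_0 -> V}]); last first.
    by apply/setP => f; rewrite !inE; apply/andP; split; apply/forallP => -[].
  by rewrite cardsT card_ffun card_ord expn0.
set E := [set f | _].
rewrite -sum1_card (partition_big (fun f : {ffun 'I_k.+1 -> V} => f ord0)
  (mem (T 0%N))) /=; last first.
  by move=> f; rewrite inE => /andP[/forallP/(_ ord0)].
apply: eq_bigr => v vT.
pose cns (g : {ffun 'I_k -> V}) : {ffun 'I_k.+1 -> V} :=
  [ffun i => if unlift ord0 i is Some j then g j else v].
pose tl (f : {ffun 'I_k.+1 -> V}) : {ffun 'I_k -> V} := [ffun i => f (lift ord0 i)].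
rewrite (reindex_onto cns tl); last first.
  move=> f /andP[_ /eqP fv]; apply/ffunP => i; rewrite ffunE.
  by case: unliftP => [j|] ->; rewrite ?ffunE.
have cns0 g : cns g ord0 = v by rewrite ffunE unlift_none.
have cnsS g j : cns g (lift ord0 j) = g j by rewrite ffunE liftK.
rewrite sum1_card IHk; apply/esym/eq_card => g; rewrite unfold_in !inE cns0 eqxx andbT.
have -> : tl (cns g) == g by apply/eqP/ffunP => j; rewrite ffunE cnsS.
rewrite andbT; apply/esym; apply/idP/idP.
  move=> /andP[/forallP h1 /forallP h2]; apply/andP; split.
    apply/forallP => j; case: (unliftP ord0 j) => [j'|] ->; last by rewrite cns0.
    by have := h1 j'; rewrite cnsS finset.in_setI => /andP[].
  apply/forallP => i; apply/forallP => j; apply/implyP.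
  case: (unliftP ord0 j) => [j'|] -> //; rewrite cnsS.
  case: (unliftP ord0 i) => [i'|] ->; last first.
    by rewrite cns0; have := h1 j'; rewrite finset.in_setI => /andP[].
  rewrite cnsS !lift0 => ij; have /forallP/(_ j')/implyP := h2 i'; exact.
move=> /andP[/forallP h1 /forallP h2]; apply/andP; split.
  apply/forallP => j; rewrite finset.in_setI.
  have := h1 (lift ord0 j); rewrite cnsS => -> /=.
  by have /forallP/(_ (lift ord0 j)) := h2 ord0; rewrite cns0 cnsS.
apply/forallP => i; apply/forallP => j; apply/implyP => ij.
by have /forallP/(_ (lift ord0 j))/implyP := h2 (lift ord0 i); rewrite !cnsS; exact.
Qed.

(** The adjacency of [H] read on natural numbers, false outside the vertex
    set. *)
Definition pattern (s : nat) (H : sgraph 'I_s) (i j : nat) : bool :=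
  [exists x : 'I_s, [exists y : 'I_s, [&& val x == i, val y == j & adj H x y]]].

Lemma pattern_ord (s : nat) (H : sgraph 'I_s) (x y : 'I_s) :
  pattern H x y = adj H x y.
Proof.
apply/existsP/idP => [[x' /existsP[y' /and3P[/eqP/val_inj-> /eqP/val_inj->]]]//|h].
by exists x; apply/existsP; exists y; rewrite !eqxx.
Qed.

Lemma card_embeddings_ext (V : finType) (s : nat) (G : sgraph V) (H : sgraph 'I_s) :
  #|embeddings G H| = ext (adj G) s (pattern H) (fun=> [set: V]).
Proof.
rewrite extE; apply: eq_card => f; rewrite [in RHS]inE.
apply/embeddingsP/idP => [[fI fA]|].
  apply/andP; split; apply/forallP => i; first by rewrite finset.in_setT.
  apply/forallP => j; apply/implyP => ij; rewrite inE fA pattern_ord eqxx andbT.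
  by apply/eqP => /fI ji; rewrite ji ltnn in ij.
move=> /andP[_ /forallP h].
have hlt (i j : 'I_s) : (i < j)%N ->
    (f j != f i) && (adj G (f i) (f j) == adj H i j).
  move=> ij; have /forallP/(_ j) := h i.
  by rewrite ij inE pattern_ord.
split=> i j; have [ij|ij|/val_inj->] := ltngtP i j => //.
- by have /andP[/eqP ne _] := hlt _ _ ij => e; case: ne.
- by have /andP[/eqP ne _] := hlt _ _ ij => e; case: ne.
- by have /andP[_ /eqP] := hlt _ _ ij.
- by have /andP[_ /eqP] := hlt _ _ ij; rewrite adjC [RHS]adjC.
- by rewrite !adjxx.
Qed.

(** The probability that independent choices, with probability [P b] of the
    relation [b], realise the pattern [c] on [k] vertices. *)
Definition weight (R : realType) (P : bool -> R) (k : nat)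
    (c : nat -> nat -> bool) : R :=
  \prod_(i < k) \prod_(j < k | (i < j)%N) P (c i j).

Lemma weightS (R : realType) (P : bool -> R) (k : nat) (c : nat -> nat -> bool) :
  weight P k.+1 c =
  (\prod_(j < k) P (c 0%N j.+1)) * weight P k (fun i j => c i.+1 j.+1).
Proof.
rewrite /weight big_ord_recl /= big_mkcond big_ord_recl /= mul1r.
congr (_ * _); apply: eq_bigr => i _.
by rewrite big_mkcond big_ord_recl /= mul1r -big_mkcond.
Qed.

Lemma card_edges (s : nat) (H : sgraph 'I_s) :
  #|edges H| = #|[set z : 'I_s * 'I_s | (z.1 < z.2)%N && adj H z.1 z.2]|.
Proof.
set E := [set z | _].
have -> : edges H = [set [set z.1; z.2] | z in E].
  apply/setP => e; apply/idP/imsetP => [eH|[z]]; last first.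
    by rewrite inE => /andP[_ zH] ->.
  have /eqP/cards2P[x [y [xy eE]]] := card_edge eH.
  have xyH : adj H x y by rewrite /adj -eE.
  have [lt|lt|/val_inj exy] := ltngtP x y; last by rewrite exy eqxx in xy.
    by exists (x, y); rewrite // inE /= lt.
  by exists (y, x); rewrite /= 1?finset.setUC// inE /= lt adjC.
rewrite card_in_imset // => -[x y] [x' y']; rewrite !inE /= => /andP[xy _] /andP[xy' _] e.
have : x \in [set x'; y'] by rewrite -e !inE eqxx.
have : y \in [set x'; y'] by rewrite -e !inE eqxx orbT.
rewrite !inE => /orP[] /eqP ? /orP[] /eqP ?; subst => //.
- by rewrite ltnn in xy.
- by have := ltn_trans xy xy'; rewrite ltnn.
- by rewrite ltnn in xy.
Qed.

Definition edge_density (R : realType) (p : R) (b : bool) : R :=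
  if b then p else 1 - p.

Lemma weight_pattern (R : realType) (p : R) (s : nat) (H : sgraph 'I_s) : p < 1 ->
  weight (edge_density p) s (pattern H) =
  (p / (1 - p)) ^+ #|edges H| * (1 - p) ^+ 'C(s, 2).
Proof.
move=> p1; have q0 : 1 - p != 0 by rewrite subr_eq0 eq_sym lt_eqF.
have -> : weight (edge_density p) s (pattern H) =
   (\prod_(i < s) \prod_(j < s | (i < j)%N && adj H i j) (p / (1 - p))) *
   weight (fun=> 1 - p) s (pattern H).
  rewrite /weight -big_split /=; apply: eq_bigr => i _.
  rewrite big_mkcondr -big_split /=; apply: eq_bigr => j _.
  by rewrite pattern_ord /edge_density; case: ifP => _; rewrite ?mul1r// divfK.
congr (_ * _).
  rewrite pair_big_dep /= prodr_const card_edges; congr (_ ^+ _).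
  by apply: eq_card => z; rewrite inE.
elim: {H} s (pattern H) => [|s IHs] c; first by rewrite /weight big_ord0 bin0n expr0.
by rewrite weightS IHs prodr_const card_ord binS bin1 addnC exprD.
Qed.

(** * Few vertices have an atypical degree into a given set *)

(** Chebyshev's inequality, for counting. *)
Lemma card_le_sum_sqr (R : realType) (V : finType) (X : V -> R) (B : {set V})
    (m S : R) : 0 < m -> (forall v, v \in B -> m <= `|X v|) ->
  \sum_v X v ^+ 2 <= S -> #|B|%:R <= S / m ^+ 2.
Proof.
move=> m0 hB hS; rewrite ler_pdivlMr ?exprn_gt0//; apply: le_trans hS.
rewrite mulrC mulr_natr -sumr_const [leRHS](bigID (mem B)) /=.
rewrite -[leLHS]addr0 lerD ?sumr_ge0// => [|v _]; last exact: sqr_ge0.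
by apply: ler_sum => v /hB; rewrite -(@ler_sqr _ m) ?nnegrE ?(ltW m0)// real_normK ?num_real.
Qed.

(** Second-moment control of the degrees into an arbitrary set [T]: the linear
    term comes from the diagonal of the codegree matrix, the quadratic term from
    the errors in the codegrees. *)
Definition degree_variance (R : realType) (V : finType) (A : rel V)
    (P : bool -> R) (a d : R) : Prop :=
  forall (b : bool) (T : {set V}),
    \sum_v (#|T :&: nbh A b v|%:R - P b * #|T|%:R) ^+ 2
      <= a * #|T|%:R + d * #|T|%:R ^+ 2.

(** The threshold and the bound depend only on the upper bound [t] for the size
    of [T], so that candidate sets can be followed through their nominal sizes
    even when they are much smaller. *)
Lemma few_rich (R : realType) (V : finType) (A : rel V) (P : bool -> R)
    (a d e t : R) (b : bool) (T : {set V}) :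
  degree_variance A P a d -> 0 <= a -> 0 <= d -> 0 < e -> 0 <= P b -> 0 < t ->
  #|T|%:R <= t ->
  #|[set v | P b * t + e * t < #|T :&: nbh A b v|%:R]|%:R <= (a / t + d) / e ^+ 2.
Proof.
move=> var a0 d0 e0 P0 t0 Tt; have et0 : 0 < e * t by rewrite mulr_gt0.
have hvar : \sum_v (#|T :&: nbh A b v|%:R - P b * #|T|%:R) ^+ 2
    <= a * t + d * t ^+ 2.
  apply: le_trans (var b T) _.
  by apply: lerD; rewrite ler_wpM2l// lerXn2r// nnegrE// ltW.
apply: le_trans (card_le_sum_sqr et0 _ hvar) _ => [v|].
  rewrite inE => /ltW hv; rewrite ler_normr lerBrDl; apply/orP; left.
  by apply: le_trans hv; rewrite lerD2r ler_wpM2l.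
rewrite le_eqVlt; apply/orP; left; apply/eqP; field.
by rewrite !gt_eqF.
Qed.

(** Dually, [t] is a lower bound for the size of [T]: the deficit of a poor
    vertex is at least [e * #|T|], because [e <= P b]. *)
Lemma few_poor (R : realType) (V : finType) (A : rel V) (P : bool -> R)
    (a d e t : R) (b : bool) (T : {set V}) :
  degree_variance A P a d -> 0 <= a -> 0 < e -> e <= P b -> 0 < t ->
  t <= #|T|%:R ->
  #|[set v | #|T :&: nbh A b v|%:R < P b * t - e * t]|%:R <= (a / t + d) / e ^+ 2.
Proof.
move=> var a0 e0 eP t0 tT; set x : R := #|T|%:R in tT *.
have x0 : 0 < x by apply: lt_le_trans tT.
have ex0 : 0 < e * x by rewrite mulr_gt0.
apply: le_trans (card_le_sum_sqr ex0 _ (var b T)) _ => [v|]; rewrite -/x.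
  rewrite inE => hv; rewrite ler_normr opprB; apply/orP; right.
  have : (P b - e) * t <= (P b - e) * x by rewrite ler_wpM2l// subr_ge0.
  by lra.
have -> : (a * x + d * x ^+ 2) / (e * x) ^+ 2 = (a / x + d) / e ^+ 2.
  by field; rewrite !gt_eqF.
by rewrite ler_pM2r ?invr_gt0 ?exprn_gt0// lerD2r ler_wpM2l// lef_pV2.
Qed.

(** * Upper and lower bounds for the number of extensions *)

Lemma card_bigcup_le (R : realType) (V : finType) (k : nat)
    (F : 'I_k -> {set V}) (beta : R) :
  (forall j, #|F j|%:R <= beta) -> #|\bigcup_(j < k) F j|%:R <= k%:R * beta.
Proof.
move=> hF; apply: (@le_trans _ _ (\sum_(j < k) #|F j|)%:R).
  rewrite ler_nat; elim/big_ind2 : _ => [|A1 n1 A2 n2 h1 h2|//].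
    by rewrite cards0.
  by apply: leq_trans (leq_add h1 h2); rewrite cardsU leq_subr.
by rewrite natr_sum mulr_natl -[in leRHS](card_ord k) -sumr_const; apply: ler_sum.
Qed.

Lemma prod_scale (R : realType) (k : nat) (x y : nat -> R) (z : R) :
  \prod_(j < k) (y j * z * x j) =
  (\prod_(j < k) x j) * (\prod_(j < k) y j) * z ^+ k.
Proof. by rewrite !big_split /= prodr_const card_ord mulrC mulrA. Qed.

(** A vertex is bad when it cuts down some later candidate set by much less than
    the expected factor. For a good first vertex all the sizes [t j] shrink by
    [P (c 0 j) * (1 + eps)]. For a bad one they are simply kept, which loses the
    factor [\prod_j P (c 0 j) >= sigma ^+ k] once; since there are at most
    [s * beta <= eta * L] bad vertices and [L <= t 0 * sigma ^+ k.+1], all of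
    them together contribute at most the proportion [eta] of the main term.
    No record of the earlier bad choices is needed, because keeping the sizes
    preserves the invariant [L <= t j * sigma ^+ k]. *)
Lemma ext_le (R : realType) (V : finType) (A : rel V) (P : bool -> R)
    (a d eps eta sigma L beta : R) (s k : nat) (c : nat -> nat -> bool)
    (T : nat -> {set V}) (t : nat -> R) :
  degree_variance A P a d -> 0 <= a -> 0 <= d -> 0 < eps -> 0 <= eta ->
  0 < sigma <= 1 -> (forall b, sigma <= P b) -> 0 < L ->
  (a / L + d) / (eps * sigma) ^+ 2 <= beta -> s%:R * beta <= eta * L ->
  (k <= s)%N -> (forall j, (j < k)%N -> #|T j|%:R <= t j) ->
  (forall j, (j < k)%N -> L <= t j * sigma ^+ k) ->
  (ext A k c T)%:R <=
    (\prod_(j < k) t j) * weight P k c * ((1 + eps) ^+ s + eta) ^+ k.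
Proof.
move=> var a0 d0 e0 eta0 /andP[s0 s1] sP L0 hbeta hs.
have P0 b : 0 < P b by apply: lt_le_trans (sP b).
have K0 : 0 <= (1 + eps) ^+ s + eta by rewrite addr_ge0// exprn_ge0// addr_ge0// ltW.
have beta0 : 0 <= beta.
  apply: le_trans hbeta; apply: divr_ge0; last exact: sqr_ge0.
  by rewrite addr_ge0// divr_ge0// ltW.
elim: k c T t => [|k IHk] c T t ks hT ht /=.
  by rewrite /weight !big_ord0 expr0 !mulr1.
have Lt j : (j < k.+1)%N -> L <= t j.
  move=> jk; have := ht j jk => h.
  have t0 : 0 <= t j.
    by rewrite -(pmulr_lge0 _ (exprn_gt0 k.+1 s0)); apply: le_trans h; exact: ltW.
  by apply: le_trans h _; rewrite ler_piMr// exprn_ile1// ltW.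
have t0 j : (j < k.+1)%N -> 0 < t j by move=> /Lt; exact: lt_le_trans.
pose c' i j := c i.+1 j.+1; pose T' v j := T j.+1 :&: nbh A (c 0%N j.+1) v.
pose B := \bigcup_(j < k) [set v | P (c 0%N j.+1) * t j.+1 + eps * sigma * t j.+1
                                   < #|T j.+1 :&: nbh A (c 0%N j.+1) v|%:R].
have hB : #|B|%:R <= s%:R * beta.
  apply: (@le_trans _ _ (k%:R * beta)); last by rewrite ler_wpM2r// ler_nat ltnW.
  apply: card_bigcup_le => j; have jk : (j.+1 < k.+1)%N := ltn_ord j.
  apply: (le_trans (few_rich var a0 d0 (mulr_gt0 e0 s0) (ltW (P0 _)) (t0 _ jk) (hT _ jk))).
  apply: le_trans hbeta; rewrite ler_pM2r ?invr_gt0 ?exprn_gt0 ?mulr_gt0//.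
  by rewrite lerD2r ler_wpM2l// lef_pV2 ?posrE ?t0// Lt.
set K := (1 + eps) ^+ s + eta in K0 IHk *.
pose PI := \prod_(j < k) P (c 0%N j.+1).
pose M := (\prod_(j < k) t j.+1) * weight P k c' * K ^+ k.
have W0 : 0 <= weight P k c'.
  by apply: prodr_ge0 => i _; apply: prodr_ge0 => j _; rewrite ltW.
have M0 : 0 <= M.
  by rewrite !mulr_ge0 ?exprn_ge0// prodr_ge0// => j _; rewrite ltW// t0 ?ltnS.
have PI0 : 0 <= PI by rewrite prodr_ge0// => j _; exact: ltW.
have sPI : sigma ^+ k.+1 <= PI.
  apply: (@le_trans _ _ (sigma ^+ k)); first by rewrite exprS ler_piMl// exprn_ge0 ?ltW.
  rewrite -[k in leLHS]card_ord -prodr_const; apply: ler_prod => j _.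
  by rewrite ltW//= sP.
have bad v : (ext A k c' (T' v))%:R <= M.
  apply: (IHk _ _ (fun j => t j.+1)) => [|j jk|j jk]; first exact: ltnW.
    by apply: le_trans (hT j.+1 _) => //; rewrite ler_nat subset_leq_card// subsetIl.
  apply: le_trans (ht j.+1 jk) _; rewrite ler_wpM2l ?(ltW (t0 j.+1 jk))//.
  by rewrite exprS ler_piMl// exprn_ge0 ?ltW.
have good v : v \notin B -> (ext A k c' (T' v))%:R <= M * PI * (1 + eps) ^+ s.
  move=> vB; pose t' j := P (c 0%N j.+1) * (1 + eps) * t j.+1.
  apply: (@le_trans _ _ ((\prod_(j < k) t' j) * weight P k c' * K ^+ k)).
    apply: (IHk _ _ t') => [|j jk|j jk]; first exact: ltnW.
      have : v \notin [set v | P (c 0%N j.+1) * t j.+1 + eps * sigma * t j.+1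
                       < #|T j.+1 :&: nbh A (c 0%N j.+1) v|%:R].
        by apply: contra vB => h; apply/bigcupP; exists (Ordinal jk).
      rewrite inE -leNgt => /le_trans; apply.
      rewrite /t' mulrDr mulr1 [leRHS]mulrDl lerD2l -!mulrA mulrCA.
      by rewrite ler_wpM2r ?sP// mulr_ge0 ?(ltW e0) ?(ltW (t0 j.+1 jk)).
    apply: le_trans (ht j.+1 jk) _; rewrite exprS mulrA ler_wpM2r ?exprn_ge0 ?(ltW s0)//.
    rewrite mulrC ler_wpM2r ?(ltW (t0 j.+1 jk))//; apply: le_trans (sP (c 0%N j.+1)) _.
    by rewrite ler_peMr ?ltW// ltrDl.
  rewrite (prod_scale k (fun j => t j.+1) (fun j => P (c 0%N j.+1))) -/PI.
  rewrite [leLHS](_ : _ = M * PI * (1 + eps) ^+ k); last by rewrite /M; ring.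
  by rewrite ler_wpM2l ?(mulr_ge0 M0 PI0)// ler_weXn2l ?lerDl ?(ltW e0)// ltnW.
rewrite natr_sum weightS big_ord_recl /= exprS -/PI.
rewrite [leRHS](_ : _ = M * PI * t 0%N * K); last by rewrite /M /c'; ring.
rewrite (bigID (mem B)) /= [leRHS](_ : _ = M * (eta * (t 0%N * PI)) +
  M * PI * (1 + eps) ^+ s * t 0%N); last by rewrite /K; ring.
apply: lerD.
  apply: (@le_trans _ _ (\sum_(i in B) M)).
    rewrite [leRHS](bigID (mem (T 0%N))) /= -[leLHS]addr0 lerD//; last first.
      by apply: sumr_ge0.
    rewrite [leRHS](eq_bigl (fun i => (i \in T 0%N) && (i \in B))); last first.
      by move=> i; rewrite andbC.
    by apply: ler_sum => i _; exact: bad.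
  rewrite sumr_const -mulr_natr ler_wpM2l//; apply: le_trans hB _.
  apply: le_trans hs _; rewrite ler_wpM2l//; apply: le_trans (ht 0%N _) _ => //.
  by rewrite ler_wpM2l// ltW// t0.
apply: (@le_trans _ _ (\sum_(i in T 0%N) M * PI * (1 + eps) ^+ s)).
  have X0 : 0 <= M * PI * (1 + eps) ^+ s.
    by rewrite (mulr_ge0 (mulr_ge0 M0 PI0))// exprn_ge0// addr_ge0// ltW.
  rewrite [leRHS](bigID (mem B)) /= -[leLHS]add0r lerD ?sumr_ge0//.
  by apply: ler_sum => i /andP[_]; exact: good.
rewrite sumr_const -mulr_natr ler_wpM2l// ?hT//.
by rewrite (mulr_ge0 (mulr_ge0 M0 PI0))// exprn_ge0// addr_ge0// ltW.
Qed.

(** For the lower bound bad vertices, those that cut down some candidate set by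
    too much, are never chosen; they are at most the proportion [eta] of the
    first candidate set. *)
Lemma ext_ge (R : realType) (V : finType) (A : rel V) (P : bool -> R)
    (a d eps eta sigma L beta : R) (s k : nat) (c : nat -> nat -> bool)
    (T : nat -> {set V}) (t : nat -> R) :
  degree_variance A P a d -> 0 <= a -> 0 <= d -> 0 < eps <= 1 -> 0 <= eta <= 1 ->
  0 < sigma <= 1 -> (forall b, sigma <= P b * (1 - eps)) -> 0 < L ->
  (a / L + d) / (eps * sigma) ^+ 2 <= beta -> s%:R * beta <= eta * L ->
  (k <= s)%N -> (forall j, (j < k)%N -> t j <= #|T j|%:R) ->
  (forall j, (j < k)%N -> L <= t j * sigma ^+ k) ->
  (\prod_(j < k) t j) * weight P k c * ((1 - eps) ^+ s * (1 - eta)) ^+ k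
    <= (ext A k c T)%:R.
Proof.
move=> var a0 d0 /andP[e0 e1] /andP[eta0 eta1] /andP[s0 s1] sPe L0 hbeta hs.
have e1' : 0 <= 1 - eps <= 1 by lra.
case/andP: e1' => e2 e3.
have P0 b : 0 < P b.
  have := lt_le_trans s0 (sPe b); have [->|en] := eqVneq eps 1.
    by rewrite subrr mulr0 ltxx.
  by rewrite pmulr_lgt0// subr_gt0 lt_neqAle en.
have sP b : sigma <= P b by apply: le_trans (sPe b) _; rewrite ler_piMr// ltW.
have K0 : 0 <= (1 - eps) ^+ s * (1 - eta) by rewrite mulr_ge0 ?exprn_ge0// subr_ge0.
have beta0 : 0 <= beta.
  apply: le_trans hbeta; apply: divr_ge0; last exact: sqr_ge0.
  by rewrite addr_ge0// divr_ge0// ltW.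
elim: k c T t => [|k IHk] c T t ks hT ht /=.
  by rewrite /weight !big_ord0 expr0 !mulr1.
have Lt j : (j < k.+1)%N -> L <= t j.
  move=> jk; have := ht j jk => h.
  have t0 : 0 <= t j.
    by rewrite -(pmulr_lge0 _ (exprn_gt0 k.+1 s0)); apply: le_trans h; exact: ltW.
  by apply: le_trans h _; rewrite ler_piMr// exprn_ile1// ltW.
have t0 j : (j < k.+1)%N -> 0 < t j by move=> /Lt; exact: lt_le_trans.
pose c' i j := c i.+1 j.+1; pose T' v j := T j.+1 :&: nbh A (c 0%N j.+1) v.
pose B := \bigcup_(j < k) [set v | #|T j.+1 :&: nbh A (c 0%N j.+1) v|%:R
                < P (c 0%N j.+1) * t j.+1 - eps * sigma * t j.+1].
have hB : #|B|%:R <= s%:R * beta.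
  apply: (@le_trans _ _ (k%:R * beta)); last by rewrite ler_wpM2r// ler_nat ltnW.
  apply: card_bigcup_le => j; have jk : (j.+1 < k.+1)%N := ltn_ord j.
  have esP : eps * sigma <= P (c 0%N j.+1).
    by apply: le_trans (sP _); rewrite ler_piMl// ltW.
  apply: (le_trans (few_poor var a0 (mulr_gt0 e0 s0) esP (t0 _ jk) (hT _ jk))).
  apply: le_trans hbeta; rewrite ler_pM2r ?invr_gt0 ?exprn_gt0 ?mulr_gt0//.
  by rewrite lerD2r ler_wpM2l// lef_pV2 ?posrE ?t0// Lt.
set K := (1 - eps) ^+ s * (1 - eta) in K0 IHk *.
pose PI := \prod_(j < k) P (c 0%N j.+1).
pose M := (\prod_(j < k) t j.+1) * weight P k c' * K ^+ k.
have W0 : 0 <= weight P k c'.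
  by apply: prodr_ge0 => i _; apply: prodr_ge0 => j _; rewrite ltW.
have M0 : 0 <= M.
  by rewrite !mulr_ge0 ?exprn_ge0// prodr_ge0// => j _; rewrite ltW// t0 ?ltnS.
have PI0 : 0 <= PI by rewrite prodr_ge0// => j _; exact: ltW.
have good v : v \notin B -> M * PI * (1 - eps) ^+ s <= (ext A k c' (T' v))%:R.
  move=> vB; pose t' j := P (c 0%N j.+1) * (1 - eps) * t j.+1.
  apply: (@le_trans _ _ ((\prod_(j < k) t' j) * weight P k c' * K ^+ k)); last first.
    apply: (IHk _ _ t') => [|j jk|j jk]; first exact: ltnW.
      have : v \notin [set v | #|T j.+1 :&: nbh A (c 0%N j.+1) v|%:R
                < P (c 0%N j.+1) * t j.+1 - eps * sigma * t j.+1].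
        by apply: contra vB => h; apply/bigcupP; exists (Ordinal jk).
      rewrite inE -leNgt; apply: le_trans.
      rewrite /t' mulrBr mulr1 mulrBl lerD2l lerN2 -!mulrA mulrCA.
      by rewrite ler_wpM2r ?sP// mulr_ge0 ?(ltW e0) ?(ltW (t0 j.+1 jk)).
    apply: le_trans (ht j.+1 jk) _; rewrite exprS mulrA ler_wpM2r ?exprn_ge0 ?(ltW s0)//.
    by rewrite mulrC ler_wpM2r ?(ltW (t0 j.+1 jk)).
  rewrite (prod_scale k (fun j => t j.+1) (fun j => P (c 0%N j.+1))) -/PI.
  rewrite [leRHS](_ : _ = M * PI * (1 - eps) ^+ k); last by rewrite /M; ring.
  by rewrite ler_wpM2l ?(mulr_ge0 M0 PI0)// ler_wiXn2l// ltnW.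
rewrite natr_sum weightS big_ord_recl /= exprS -/PI.
rewrite [leLHS](_ : _ = M * PI * (1 - eps) ^+ s * (t 0%N * (1 - eta)));
  last by rewrite /M /c' /K; ring.
have X0 : 0 <= M * PI * (1 - eps) ^+ s by rewrite (mulr_ge0 (mulr_ge0 M0 PI0))// exprn_ge0.
apply: (@le_trans _ _ (\sum_(i in T 0%N :\: B) M * PI * (1 - eps) ^+ s)); last first.
  rewrite [leRHS](bigID (mem B)) /= -[leLHS]add0r lerD ?sumr_ge0//.
  rewrite (eq_bigl (fun i => (i \in T 0%N) && (i \notin B))); last first.
    by move=> i; rewrite finset.in_setD andbC.
  by apply: ler_sum => i /andP[_]; exact: good.
rewrite sumr_const -mulr_natr ler_wpM2l//.
have hcard : #|T 0%N|%:R <= #|T 0%N :\: B|%:R + #|B|%:R :> R.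
  rewrite -natrD ler_nat -(cardsID B (T 0%N)) addnC leq_add2l.
  by rewrite subset_leq_card// subsetIr.
have h1 : #|B|%:R <= eta * t 0%N.
  apply: le_trans hB _; apply: le_trans hs _; rewrite ler_wpM2l//; exact: Lt.
by have := hT 0%N isT; lra.
Qed.

(** * Codegrees control the variance of the degrees *)

Definition centred (R : realType) (V : finType) (G : sgraph V) (p : R)
    (v u : V) : R := (adj G v u)%:R - p.

Lemma sum_natb (R : realType) (V : finType) (A B : pred V) :
  \sum_(v in A) (B v)%:R = #|[set v in A | B v]|%:R :> R.
Proof.
rewrite -sum1_card natr_sum [RHS](eq_bigl (fun v => (v \in A) && B v)).
  by rewrite big_mkcondr /=; apply: eq_bigr => v _; case: (B v).
by move=> v; rewrite inE.
Qed.

(** The off-diagonal sums are combinations of one codegree error and two degree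
    errors, the latter weighted by [p <= 1]. *)
Lemma centred_product_le (R : realType) (V : finType) (G : sgraph V) (p D : R)
    (u u' : V) : 0 <= p <= 1 -> 0 <= D ->
  (forall v, `|#|neighbours G v|%:R - #|V|%:R * p| <= D) ->
  (forall v v', v != v' ->
    `|#|neighbours G v :&: neighbours G v'|%:R - #|V|%:R * p ^+ 2| <= D) ->
  \sum_v centred G p v u * centred G p v u' <= (u == u')%:R * #|V|%:R + 3 * D.
Proof.
move=> /andP[p0 p1] D0 hdeg hcodeg; have [->|uu'] := eqVneq u u'.
  rewrite mul1r -[leLHS]addr0 lerD ?mulr_ge0//.
  rewrite -sum1_card natr_sum; apply: ler_sum => v _.
  by rewrite /centred; case: adj => /=; nra.
rewrite mul0r add0r.
have degE w : \sum_v (adj G v w)%:R = #|neighbours G w|%:R :> R.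
  by rewrite sum_natb; congr _%:R; apply: eq_card => v; rewrite !inE.
have codegE : \sum_v ((adj G v u)%:R * (adj G v u')%:R) =
    #|neighbours G u :&: neighbours G u'|%:R :> R.
  under eq_bigr do rewrite -natrM mulnb.
  by rewrite sum_natb; congr _%:R; apply: eq_card => v; rewrite !inE.
have -> : \sum_v centred G p v u * centred G p v u' =
    (#|neighbours G u :&: neighbours G u'|%:R - #|V|%:R * p ^+ 2)
    - p * (#|neighbours G u|%:R - #|V|%:R * p)
    - p * (#|neighbours G u'|%:R - #|V|%:R * p).
  rewrite -codegE -!degE.
  under eq_bigr => v _.
    rewrite (_ : _ * _ = (adj G v u)%:R * (adj G v u')%:R - p * (adj G v u)%:R
       - p * (adj G v u')%:R + p ^+ 2); last by rewrite /centred; ring.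
    over.
  rewrite !big_split /= !sumrN -!mulr_sumr sumr_const -mulr_natl.
  rewrite (_ : #|xpredT| = #|V|)//; ring.
have := hcodeg _ _ uu'; have := hdeg u; have := hdeg u'.
rewrite !ler_norml => /andP[h1 _] /andP[h2 _] /andP[_ h3]; nra.
Qed.

(** Expanding the square of the centred degree into [T] gives a sum of inner
    products of centred columns over the pairs of vertices of [T]. For
    non-adjacency the deviation is the opposite of that for adjacency, up to the
    vertex itself, which doubles the constants. *)
Lemma codegree_variance (R : realType) (V : finType) (G : sgraph V) (p D : R) :
  0 <= p <= 1 -> 0 <= D ->
  (forall v, `|#|neighbours G v|%:R - #|V|%:R * p| <= D) ->
  (forall v v', v != v' ->
    `|#|neighbours G v :&: neighbours G v'|%:R - #|V|%:R * p ^+ 2| <= D) ->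
  degree_variance (adj G) (edge_density p) (4 * #|V|%:R) (6 * D).
Proof.
move=> p01 D0 hdeg hcodeg b T.
pose W v := \sum_(u in T) centred G p v u.
have sumW : \sum_v W v ^+ 2 <= #|V|%:R * #|T|%:R + 3 * D * #|T|%:R ^+ 2.
  have -> : \sum_v W v ^+ 2 = \sum_(u in T) \sum_(u' in T)
      \sum_v centred G p v u * centred G p v u'.
    under eq_bigr do rewrite expr2 mulr_suml.
    rewrite exchange_big /=; apply: eq_bigr => u _.
    by rewrite [RHS]exchange_big /=; apply: eq_bigr => v _; rewrite mulr_sumr.
  have -> : #|V|%:R * #|T|%:R + 3 * D * #|T|%:R ^+ 2 =
     \sum_(u in T) \sum_(u' in T) ((u == u')%:R * #|V|%:R + 3 * D).
    under eq_bigr => u uT.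
      rewrite big_split /= -mulr_suml sumr_const (bigD1 u)//= eqxx big1 ?addr0.
        rewrite mul1r; over.
      by move=> u' /andP[_]; rewrite eq_sym => /negbTE->.
    by rewrite sumr_const -mulr_natr -[_ *+ #|T|]mulr_natr; ring.
  apply: ler_sum => u _; apply: ler_sum => u' _.
  exact: centred_product_le.
have cardE v (b' : bool) : #|T :&: nbh (adj G) b' v|%:R =
    \sum_(u in T) ((u != v) && (adj G v u == b'))%:R :> R.
  by rewrite sum_natb; congr _%:R; apply: eq_card => u; rewrite !inE.
have TE x : x * #|T|%:R = \sum_(u in T) x :> R by rewrite sumr_const mulr_natr.
have devT v : #|T :&: nbh (adj G) true v|%:R - edge_density p true * #|T|%:R = W v.
  rewrite cardE TE -sumrB; apply: eq_bigr => u _; rewrite /centred eqb_id.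
  by case: eqVneq => [->|//]; rewrite adjxx.
have devF v : #|T :&: nbh (adj G) false v|%:R - edge_density p false * #|T|%:R
    = - (W v + (v \in T)%:R).
  have -> : (v \in T)%:R = \sum_(u in T) (u == v)%:R :> R.
    rewrite sum_natb; case: (boolP (v \in T)) => vT.
      rewrite (_ : [set _ in _ | _] = [set v]) ?cards1//.
      by apply/setP => u; rewrite !inE; case: eqVneq => [->|]; rewrite ?vT ?andbF.
    rewrite (_ : [set _ in _ | _] = finset.set0) ?cards0//.
    by apply/setP => u; rewrite !inE; case: eqVneq => [->|]; rewrite ?(negbTE vT) ?andbF.
  rewrite cardE TE -sumrB -big_split /= -sumrN; apply: eq_bigr => u _.
  rewrite /centred /edge_density; case: eqVneq => [->|_]; first by rewrite adjxx /=; ring.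
  by case: adj => /=; ring.
have TV : #|T|%:R <= #|V|%:R * #|T|%:R :> R.
  rewrite -natrM ler_nat; have [->|T0] := posnP #|T|; first by rewrite muln0.
  by rewrite leq_pmull// (leq_trans T0 (max_card _)).
have W0 : 0 <= \sum_v W v ^+ 2 by apply: sumr_ge0 => v _; exact: sqr_ge0.
have DT : 0 <= D * #|T|%:R ^+ 2 by rewrite mulr_ge0// sqr_ge0.
have VT : 0 <= #|V|%:R * #|T|%:R :> R by rewrite mulr_ge0.
case: b.
  under eq_bigr do rewrite devT.
  by lra.
under eq_bigr do rewrite devF sqrrN.
apply: (@le_trans _ _ (\sum_v (2 * W v ^+ 2 + 2 * (v \in T)%:R))).
  apply: ler_sum => v _; case: (v \in T) => /=; last by rewrite !addr0 mulr0; nra.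
  by have := sqr_ge0 (W v - 1); nra.
rewrite big_split /= -!mulr_sumr.
have -> : \sum_v (v \in T)%:R = #|T|%:R :> R.
  by rewrite sum_natb; congr _%:R; apply: eq_card => v; rewrite !inE.
by lra.
Qed.

(** * The relative error for a given number of vertices *)

Lemma bernoulli_ineq (R : realType) (x : R) (N : nat) : 0 <= x <= 1 ->
  1 - N%:R * x <= (1 - x) ^+ N.
Proof.
move=> /andP[x0 x1]; elim: N => [|N IH]; first by rewrite mul0r subr0 expr0.
rewrite exprS -natr1.
have N0 : 0 <= N%:R :> R by [].
have : (1 - x) * (1 - N%:R * x) <= (1 - x) * (1 - x) ^+ N.
  by rewrite ler_wpM2l// subr_ge0.
have : 0 <= N%:R * x * x by rewrite !mulr_ge0.
by lra.
Qed.

Lemma ffact_le_exp (n s : nat) : (n ^_ s <= n ^ s)%N.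
Proof.
elim: s => // s IH; rewrite ffactnSr expnSr; apply: leq_mul IH _.
exact: leq_subr.
Qed.

Lemma ffact_ge_exp (R : realType) (n s : nat) : (0 < n)%N -> (s <= n)%N ->
  n%:R ^+ s * (1 - s%:R ^+ 2 / n%:R) <= (n ^_ s)%:R :> R.
Proof.
move=> n0 sn; have n0' : 0 < n%:R :> R by rewrite ltr0n.
apply: (@le_trans _ _ (n%:R ^+ s * (1 - s%:R / n%:R) ^+ s)).
  rewrite ler_wpM2l ?exprn_ge0// expr2 -mulrA; apply: bernoulli_ineq.
  by rewrite divr_ge0//= ler_pdivrMr// mul1r ler_nat.
have -> : n%:R ^+ s * (1 - s%:R / n%:R) ^+ s = ((n - s) ^ s)%:R :> R.
  by rewrite natrX natrB// -exprMn mulrBr mulr1 mulrCA divff ?mulr1// gt_eqF.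
rewrite ler_nat.
have : forall k, (k <= s)%N -> ((n - s) ^ k <= n ^_ k)%N.
  elim=> // k IH ks; rewrite ffactnSr expnSr.
  by apply: leq_mul; [apply: IH; exact: ltnW|rewrite leq_sub2l// ltnW].
exact.
Qed.

(** The two inductions with all candidate sets full, [t] equal to [n] and
    [eta = eps]. Both main factors are then controlled by
    [(1 - eps) ^+ (s * s.+1)], since [(1 + eps) * (1 - eps) <= 1], and
    [s ^ 2 / n] accounts for the difference between [n ^_ s] and [n ^ s]. *)
Lemma relative_error_le (R : realType) (p D eps z : R) (n s : nat)
    (G : sgraph 'I_n) (H : sgraph 'I_s) :
  0 < p < 1 -> 0 <= D -> (0 < n)%N -> 0 < eps < 1 ->
  (forall v, `|#|neighbours G v|%:R - n%:R * p| <= D) ->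
  (forall v v', v != v' ->
    `|#|neighbours G v :&: neighbours G v'|%:R - n%:R * p ^+ 2| <= D) ->
  let sigma := Num.min p (1 - p) * (1 - eps) in
  let L := n%:R * sigma ^+ s in
  s%:R * ((4 * n%:R / L + 6 * D) / (eps * sigma) ^+ 2) <= eps * L ->
  (s * s.+1)%:R * eps + s%:R ^+ 2 / n%:R <= z -> z <= 1 / 2 ->
  `|(induced_copies G H)%:R / expected_copies p n H - 1| <= 2 * z.
Proof.
move=> /andP[p0 p1] D0 n0 /andP[e0 e1] hdeg hcodeg sigma L hs hz z2.
have n0' : 0 < n%:R :> R by rewrite ltr0n.
have rho0 : 0 < Num.min p (1 - p) by rewrite lt_min p0 subr_gt0.
have sigma0 : 0 < sigma by rewrite mulr_gt0// subr_gt0.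
have L0 : 0 < L by rewrite mulr_gt0// exprn_gt0.
have sP b : sigma <= edge_density p b * (1 - eps).
  rewrite ler_wpM2r ?subr_ge0 ?(ltW e1)//.
  by case: b; rewrite /edge_density ge_min lexx ?orbT.
have q0 : 0 < 1 - p by rewrite subr_gt0.
have P01 b : 0 < edge_density p b <= 1.
  by case: b; rewrite /edge_density; apply/andP; split; lra.
have sP' b : sigma <= edge_density p b.
  apply: le_trans (sP b) _; have /andP[P0 _] := P01 b.
  by rewrite ler_piMr ?(ltW P0)// lerBlDr lerDl ltW.
have sigma1 : sigma <= 1 by apply: le_trans (sP' true) _; have /andP[] := P01 true.
have var : degree_variance (adj G) (edge_density p) (4 * n%:R) (6 * D).
  rewrite -[n in 4 * n%:R]card_ord; apply: codegree_variance => //.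
  - by rewrite !ltW.
  - by move=> v; rewrite card_ord.
  - by move=> v v' ?; rewrite card_ord; exact: hcodeg.
have a0 : 0 <= 4 * n%:R :> R by rewrite mulr_ge0.
have d0 : 0 <= 6 * D by rewrite mulr_ge0.
pose X : R := #|embeddings G H|%:R; pose W := weight (edge_density p) s (pattern H).
have cardn : #|[set: 'I_n]|%:R = n%:R :> R by rewrite cardsT card_ord.
have Xle : X <= n%:R ^+ s * W * ((1 + eps) ^+ s + eps) ^+ s.
  rewrite /X card_embeddings_ext.
  have := @ext_le _ _ _ _ _ _ eps eps sigma L _ s s (pattern H)
    (fun=> [set: 'I_n]) (fun=> n%:R) var a0 d0 e0 (ltW e0) _ sP' L0 (lexx _) hs (leqnn s).
  rewrite prodr_const card_ord; apply; rewrite ?sigma0// => j js.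
  by rewrite cardn.
have Xge : n%:R ^+ s * W * ((1 - eps) ^+ s * (1 - eps)) ^+ s <= X.
  rewrite /X card_embeddings_ext.
  have := @ext_ge _ _ _ _ _ _ eps eps sigma L _ s s (pattern H)
    (fun=> [set: 'I_n]) (fun=> n%:R) var a0 d0 _ _ _ sP L0 (lexx _) hs (leqnn s).
  rewrite prodr_const card_ord; apply; rewrite ?sigma0 ?e0 ?(ltW e0) ?(ltW e1)// => j js.
  by rewrite cardn.
have W0 : 0 < W.
  by apply: prodr_gt0 => i _; apply: prodr_gt0 => j _; have /andP[] := P01 (pattern H i j).
have e01 : 0 <= eps <= 1 by rewrite !ltW.
have Ne0 : 0 <= (s * s.+1)%:R * eps by rewrite mulr_ge0// ltW.
have sn0 : 0 <= s%:R ^+ 2 / n%:R :> R by rewrite divr_ge0 ?sqr_ge0.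
have sn : (s <= n)%N.
  have : s%:R ^+ 2 / n%:R <= 1 :> R by lra.
  rewrite ler_pdivrMr// mul1r -natrX ler_nat; apply: leq_trans.
  by case: (s) => // s'; rewrite leq_pmulr.
have F0 : 0 < (n ^_ s)%:R :> R by rewrite ltr0n ffact_gt0.
have ns0 : 0 < n%:R ^+ s :> R by rewrite exprn_gt0.
have -> : (induced_copies G H)%:R / expected_copies p n H = X / ((n ^_ s)%:R * W).
  have a_gt0 : #|aut_set H|%:R != 0 :> R.
    rewrite pnatr_eq0 -lt0n; apply/card_gt0P; exists 1%g; rewrite inE.
    apply/asboolP; split=> [|x y]; last by rewrite !perm1.
    by exists id => x; rewrite perm1.
  rewrite /X -induced_copies_aut natrM /expected_copies -mulrA -weight_pattern// -/W.
  by field; rewrite a_gt0 !gt_eqF.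
have lowE : ((1 - eps) ^+ s * (1 - eps)) ^+ s = (1 - eps) ^+ (s * s.+1).
  by rewrite -exprSr -exprM mulnC.
have bern := bernoulli_ineq (s * s.+1) e01.
have FW0 : 0 < (n ^_ s)%:R * W by rewrite mulr_gt0.
rewrite ler_norml; apply/andP; split.
  rewrite lerBrDr ler_pdivlMr//; apply: le_trans Xge; rewrite lowE.
  rewrite [leRHS](_ : _ = (1 - eps) ^+ (s * s.+1) * n%:R ^+ s * W); last by ring.
  rewrite mulrA ler_pM2r//.
  apply: ler_pM; rewrite ?(ltW F0)//; [by lra|by lra|].
  by rewrite -natrX ler_nat ffact_le_exp.
rewrite lerBlDr ler_pdivrMr//; apply: le_trans Xle _.
rewrite [leLHS](_ : _ = n%:R ^+ s * ((1 + eps) ^+ s + eps) ^+ s * W); last by ring.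
rewrite mulrA ler_pM2r//.
set K := ((1 + eps) ^+ s + eps) ^+ s.
set y := (s * s.+1)%:R * eps in hz Ne0 bern *.
set w := s%:R ^+ 2 / n%:R in hz sn0 *.
have K0 : 0 <= K by rewrite exprn_ge0// addr_ge0 ?exprn_ge0 ?addr_ge0// ltW.
have Kle : K * (1 - y) <= 1.
  apply: (@le_trans _ _ ((1 + eps) ^+ (s * s.+1) * (1 - eps) ^+ (s * s.+1))).
    apply: ler_pM => //; first by lra.
    rewrite mulnC exprM lerXn2r ?nnegrE ?exprn_ge0 ?addr_ge0 ?exprn_ge0 ?addr_ge0 ?(ltW e0)//.
    rewrite exprSr mulrDr mulr1 lerD2l ler_peMl ?(ltW e0)// exprn_ege1// lerDl ltW//.
  rewrite -exprMn exprn_ile1//; nra.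
have Fge := ffact_ge_exp R n0 sn; rewrite -/w in Fge.
have h1 : 1 <= (2 * z + 1) * ((1 - y) * (1 - w)).
  have z0 : 0 <= z by lra.
  have yw0 : 0 <= y * w by rewrite mulr_ge0.
  apply: (@le_trans _ _ ((2 * z + 1) * (1 - z))); first by nra.
  by rewrite ler_wpM2l//; lra.
have yw : 0 < (1 - y) by lra.
have ww : 0 < (1 - w) by lra.
rewrite -(ler_pM2r yw) -(ler_pM2r ww).
apply: (@le_trans _ _ (n%:R ^+ s * (1 - w))).
  by rewrite ler_pM2r// -mulrA ler_piMr// ltW.
apply: le_trans Fge _.
rewrite [leRHS](_ : _ = (n ^_ s)%:R * ((2 * z + 1) * ((1 - y) * (1 - w))));
  last by ring.
by rewrite ler_peMr ?(ltW F0).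
Qed.

(** * Choice of the parameters as n grows *)

Lemma gammaE (R : realType) (p : R) : 0 < p < 1 ->
  gamma p = (Num.min p (1 - p))^-1.
Proof.
move=> /andP[p0 p1]; have q0 : 0 < 1 - p by rewrite subr_gt0.
rewrite /gamma; have [pq|qp] := leP p (1 - p).
  by apply/max_idPl; rewrite lef_pV2.
by apply/max_idPr; rewrite lef_pV2// ltW.
Qed.

(** With [n = expR l], the size bound implies that [n * rho ^+ s] exceeds
    [n ^ (1 - alpha)] by a power of the logarithm, whose exponent is fixed by the
    coefficient of the iterated logarithm. *)
Lemma size_bound_decay (R : realType) (rho l alpha : R) (K s : nat) :
  0 < rho < 1 -> 1 <= l -> alpha <= 1 / 2 ->
  s%:R <= alpha * (l / - ln rho) - K%:R / - ln rho * ln l ->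
  [/\ s%:R <= (- ln rho)^-1 * l &
      expR ((1 - alpha) * l) * l ^+ K <= expR l * rho ^+ s].
Proof.
move=> /andP[rho0 rho1] l1 al hs; have l0 : 0 < l by apply: lt_le_trans l1.
have g0 : 0 < - ln rho by rewrite oppr_gt0 ln_lt0// rho0.
set g := - ln rho in hs g0 *.
have lnl : 0 <= ln l by apply: ln_ge0.
have hs' : s%:R * g <= alpha * l - K%:R * ln l.
  by rewrite -ler_pdivlMr//; apply: le_trans hs _; rewrite mulrBl !mulrA [K%:R / g * _]mulrAC.
split.
  rewrite mulrC ler_pdivlMr//; apply: le_trans hs' _.
  have : 0 <= K%:R * ln l by rewrite mulr_ge0.
  by have : 0 <= (1 - alpha) * l; [apply: mulr_ge0; lra|lra].
have -> : rho ^+ s = expR (s%:R * (- g)) by rewrite expRM_natl opprK lnK.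
have -> : l ^+ K = expR (K%:R * ln l) by rewrite expRM_natl lnK.
by rewrite -!expRD ler_expR; lra.
Qed.

(** Here [Y] stands for [n * rho ^+ s], a lower bound for the expected sizes of
    all candidate sets. Its square exceeds the number [N] of vertices, and it
    exceeds the codegree error [D] itself, by a factor of order [l ^+ 11]. The
    powers of [l] are spent as follows: one on [s <= a * l], six on [eps ^+ 2]
    and three on the factor [eps] on the right; the remaining one absorbs the
    constants. *)
Lemma bad_fraction_le (R : realType) (a rho l Y N D C L s eps : R) :
  0 < rho -> 0 < a -> 0 <= C -> 1 <= l -> 0 < Y -> eps = (l ^+ 3)^-1 ->
  eps <= 1 / 2 -> 0 <= s <= a * l -> 8 * a * (8 + 6 * C) / rho ^+ 2 <= l ->
  N * l ^+ 11 <= Y ^+ 2 -> D * l ^+ 11 <= C * Y -> 0 <= D -> 0 <= N ->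
  Y / 2 <= L ->
  s * ((4 * N / L + 6 * D) / (eps * (rho * (1 - eps))) ^+ 2) <= eps * L.
Proof.
move=> rho0 a0 C0 l1 Y0 epsE eps2 /andP[s0 sl] hl hN hD D0 N0 hL.
have l0 : 0 < l by apply: lt_le_trans l1.
have lX k : 0 < l ^+ k by rewrite exprn_gt0.
have L0 : 0 < L by apply: lt_le_trans hL; rewrite divr_gt0.
have eps0 : 0 < eps by rewrite epsE invr_gt0.
have hNL : 4 * N / L <= 8 * (Y / l ^+ 11).
  rewrite ler_pdivrMr//; apply: (@le_trans _ _ (8 * (Y / l ^+ 11) * (Y / 2))).
    rewrite -ler_pdivlMr// in hN.
    by rewrite [leRHS](_ : _ = 4 * (Y ^+ 2 / l ^+ 11)) ?ler_wpM2l//; field; rewrite gt_eqF.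
  by rewrite ler_wpM2l// mulr_ge0// divr_ge0 ?(ltW Y0) ?(ltW (lX _)).
have hDY : 6 * D <= 6 * C * (Y / l ^+ 11).
  by rewrite -ler_pdivlMr// in hD; rewrite -mulrA ler_wpM2l// mulrA.
have hnum : 4 * N / L + 6 * D <= (8 + 6 * C) * (Y / l ^+ 11).
  by apply: le_trans (lerD hNL hDY) _; rewrite -mulrDl.
have hden : (eps * (rho / 2)) ^+ 2 <= (eps * (rho * (1 - eps))) ^+ 2.
  rewrite lerXn2r ?nnegrE ?mulr_ge0 ?(ltW eps0) ?(ltW rho0)//; first by lra.
  by rewrite ler_wpM2l ?(ltW eps0)// ler_wpM2l ?(ltW rho0)//; lra.
have den0 : 0 < (eps * (rho / 2)) ^+ 2 by rewrite exprn_gt0// !mulr_gt0.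
apply: (@le_trans _ _
    (a * l * ((8 + 6 * C) * (Y / l ^+ 11) / (eps * (rho / 2)) ^+ 2))).
  apply: ler_pM => //.
    rewrite divr_ge0 ?sqr_ge0// addr_ge0// ?mulr_ge0// ?invr_ge0 ?(ltW L0)//.
  apply: ler_pM => //.
    by rewrite addr_ge0// ?mulr_ge0// ?invr_ge0 ?(ltW L0).
    by rewrite invr_ge0 sqr_ge0.
  by rewrite lef_pV2// posrE; apply: lt_le_trans hden.
have -> : a * l * ((8 + 6 * C) * (Y / l ^+ 11) / (eps * (rho / 2)) ^+ 2) =
   (8 * a * (8 + 6 * C) / rho ^+ 2) * (Y / 2 / l ^+ 4).
  by rewrite epsE; field; rewrite !gt_eqF.
apply: (@le_trans _ _ (l * (Y / 2 / l ^+ 4))).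
  by rewrite ler_wpM2r// divr_ge0 ?(ltW (lX _))// divr_ge0// ltW.
rewrite [leLHS](_ : _ = eps * (Y / 2)); last by rewrite epsE; field; rewrite !gt_eqF.
by rewrite ler_wpM2l// ltW.
Qed.

(** The relative error is of order [1 / ln n], uniformly in [H] and in [s]: with
    [eps = (ln n) ^ -3] the accumulated error [s * s.+1 * eps] has this order,
    as [s] is at most a multiple of [ln n]. *)
Lemma relative_error_asymp (R : realType) (p delta C : R) (hp : 0 < p < 1) :
  0 < delta < 1 -> 0 < C ->
  exists A M : R, [/\ 0 < A, 0 < M &
  forall (n s : nat) (G : sgraph 'I_n) (H : sgraph 'I_s),
    (0 < n)%N -> (0 < s)%N -> M <= ln (n%:R : R) ->
    s%:R <= size_bound p delta (11 / ln (gamma p)) n ->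
    (forall v, `|#|neighbours G v|%:R - n%:R * p| <= C * n%:R `^ delta) ->
    (forall v v', v != v' ->
      `|#|neighbours G v :&: neighbours G v'|%:R - n%:R * p ^+ 2|
        <= C * n%:R `^ delta) ->
    `|(induced_copies G H)%:R / expected_copies p n H - 1|
      <= A / ln (n%:R : R)].
Proof.
move=> /andP[delta0 delta1] C0; have /andP[p0 p1] := hp.
set rho := Num.min p (1 - p).
have rho01 : 0 < rho < 1 by rewrite lt_min p0 subr_gt0 p1 gt_min p1.
have /andP[rho0 rho1] := rho01.
pose a := (- ln rho)^-1.
have a0 : 0 < a by rewrite invr_gt0 oppr_gt0 ln_lt0.
(* [2 * a ^+ 2] bounds the accumulated error and [6 * a ^+ 2] the difference
   between [n ^_ s] and [n ^ s], both relative to [1 / ln n]. *)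
pose A := 8 * a ^+ 2; have A0 : 0 < A by rewrite mulr_gt0// exprn_gt0.
pose B := 8 * a * (8 + 6 * C) / rho ^+ 2.
have B0 : 0 < B.
  by rewrite divr_gt0 ?exprn_gt0// !mulr_gt0// addr_gt0// mulr_gt0.
exists (2 * A), (2 + 2 * a + 2 * A + B); split.
- by rewrite mulr_gt0.
- by rewrite !addr_gt0// mulr_gt0.
move=> n s G H n0 s0 hM hs hdeg hcodeg.
have n0' : 0 < n%:R :> R by rewrite ltr0n.
set l := ln n%:R in hM *.
have nE : n%:R = expR l by rewrite lnK.
have [l2 la lA lB] : [/\ 2 <= l, 2 * a <= l, 2 * A <= l & B <= l].
  by split; lra.
have l1 : 1 <= l by lra.
have l0 : 0 < l by lra.
have lX k : 0 < l ^+ k by rewrite exprn_gt0.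
have [sl hY] : [/\ s%:R <= a * l &
    expR ((1 - Num.min (1 - delta) (1 / 2)) * l) * l ^+ 11 <= expR l * rho ^+ s].
  apply: size_bound_decay => //; first by rewrite ge_min lexx orbT.
  by move: hs; rewrite /size_bound gammaE// lnV.
set Y := expR l * rho ^+ s in hY.
have Y0 : 0 < Y by rewrite mulr_gt0 ?expR_gt0 ?exprn_gt0.
have Yge x : x <= 1 - Num.min (1 - delta) (1 / 2) -> expR (x * l) * l ^+ 11 <= Y.
  move=> hx; apply: le_trans hY; rewrite ler_pM2r// ler_expR.
  by rewrite ler_pM2r.
have Yhalf : expR (1 / 2 * l) * l ^+ 11 <= Y.
  by apply: Yge; rewrite lerBrDl -lerBrDr ge_min; apply/orP; right; lra.
have Ydelta : expR (delta * l) * l ^+ 11 <= Y.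
  by apply: Yge; rewrite lerBrDl -lerBrDr ge_min lexx.
have DE : C * n%:R `^ delta = C * expR (delta * l) by rewrite /powR gt_eqF.
pose eps := (l ^+ 3)^-1.
have eps0 : 0 < eps by rewrite invr_gt0.
have eps_half : eps <= 1 / 2.
  rewrite /eps div1r lef_pV2 ?posrE// exprS; apply: le_trans l2 _.
  by rewrite ler_peMr ?(ltW l0)// exprn_ege1.
have s_pos : 0 <= s%:R :> R by [].
have seps : s%:R * eps <= 1 / 2.
  apply: (@le_trans _ _ (a * l * eps)); first by rewrite ler_wpM2r// ltW.
  rewrite /eps (_ : _ * _ = a / l ^+ 2); last by field; rewrite gt_eqF.
  rewrite ler_pdivrMr// expr2; have : l <= l * l by rewrite ler_peMl// ltW.
  by lra.
apply: le_trans (_ : 2 * (A / l) <= _); last by rewrite mulrA.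
apply: (@relative_error_le R p (C * n%:R `^ delta) eps) => //.
- by rewrite mulr_ge0 ?powR_ge0// ltW.
- by rewrite eps0/=; lra.
- apply: (@bad_fraction_le R a rho l Y n%:R _ C) => //; rewrite ?(ltW C0) ?s_pos ?sl//.
  + apply: (@le_trans _ _ ((expR (1 / 2 * l) * l ^+ 11) ^+ 2)).
      rewrite exprMn -expRM_natl (_ : 2%:R * (1 / 2 * l) = l); last by field.
      rewrite -nE ler_pM2l// expr2 ler_peMl ?(ltW (lX _))// exprn_ege1//.
    by rewrite lerXn2r ?nnegrE ?(ltW Y0)// mulr_ge0 ?expR_ge0 ?(ltW (lX _)).
  + by rewrite DE -mulrA ler_pM2l.
  + by rewrite mulr_ge0 ?powR_ge0// ltW.
  + rewrite exprMn mulrA nE -/Y ler_wpM2l ?(ltW Y0)//.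
    have e01 : 0 <= eps <= 1 by rewrite (ltW eps0); lra.
    by have := bernoulli_ineq s e01; lra.
- have sq : s%:R ^+ 2 <= (a * l) ^+ 2 by rewrite lerXn2r ?nnegrE ?mulr_ge0// ltW.
  have h1 : (s * s.+1)%:R * eps <= 2 * a ^+ 2 / l.
    apply: (@le_trans _ _ (2 * (a * l) ^+ 2 * eps)).
      rewrite ler_pM2r//; apply: le_trans (_ : 2 * s%:R ^+ 2 <= _); last by rewrite ler_pM2l.
      rewrite -natrX -natrM ler_nat mulnS -mulnn mul2n -addnn leq_add2r.
      by rewrite -{1}[s]muln1 leq_mul2l s0 orbT.
    rewrite le_eqVlt; apply/orP; left; apply/eqP; rewrite /eps; field.
    by rewrite gt_eqF.
  have h2 : s%:R ^+ 2 / n%:R <= 6 * a ^+ 2 / l.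
    rewrite ler_pdivrMr//; apply: le_trans sq _.
    (* The cubic term of the exponential series. *)
    have hexp : l ^+ 3 / 6 <= n%:R.
      by rewrite nE; have := expR_ge1Dxn 2 (ltW l0); rewrite (_ : (3`!)%:R = 6 :> R)//; lra.
    apply: (@le_trans _ _ (6 * a ^+ 2 / l * (l ^+ 3 / 6))).
      by rewrite le_eqVlt; apply/orP; left; apply/eqP; field; rewrite gt_eqF.
    by rewrite ler_wpM2l// divr_ge0 ?(ltW l0)// mulr_ge0// sqr_ge0.
  apply: le_trans (lerD h1 h2) _; rewrite -mulrDl /A -mulrDl.
  by rewrite ler_pM2r ?invr_gt0// ler_wpM2r ?sqr_ge0//; lra.
- by rewrite ler_pdivrMr//; lra.
Qed.

Local Open Scope classical_set_scope.

Theorem theorem1p1 (R : realType) (p : R) (hp : 0 < p < 1) :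
  exists2 C0 : R, 0 < C0 &
    forall (delta C : R) (G : forall n : nat, sgraph 'I_n),
      0 < delta < 1 -> 0 < C ->
      (forall (n : nat) (v : 'I_n),
         `|#|neighbours (G n) v|%:R - n%:R * p| < C * n%:R `^ delta) ->
      (forall (n : nat) (v v' : 'I_n), v != v' ->
         `|#|neighbours (G n) v :&: neighbours (G n) v'|%:R - n%:R * p ^+ 2|
           < C * n%:R `^ delta) ->
      max_relative_error p delta C0 G n @[n --> \oo] --> (0 : R).
Proof.
exists (11 / ln (gamma p)).
  have /andP[p0 p1] := hp; rewrite divr_gt0// gammaE// ln_gt0// invf_gt1.
    by rewrite gt_min p1.
  by rewrite lt_min p0 subr_gt0.
move=> delta C G hdelta hC hdeg hcodeg.
have [A [M [A0 M0 hA]]] := relative_error_asymp hp hdelta hC.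
apply/cvgrPdist_le => e e0.
pose B := Num.max M (A / e).
exists (Num.truncn (expR B)).+1 => // n /= hn.
have nB : expR B <= n%:R.
  apply: le_trans (_ : (Num.truncn (expR B)).+1%:R <= _); last by rewrite ler_nat.
  by rewrite ltW// truncnS_gt.
have n0' : 0 < n%:R :> R by apply: lt_le_trans nB; exact: expR_gt0.
have n0 : (0 < n)%N by rewrite ltr0n in n0'.
have lB : B <= ln n%:R by rewrite -[B]expRK ler_ln// posrE expR_gt0.
have [lM lA] : M <= ln n%:R /\ A / e <= ln n%:R.
  by split; apply: le_trans lB; rewrite le_max lexx ?orbT.
have l0 : 0 < ln (n%:R : R) by apply: lt_le_trans lM.
have le_e : A / ln n%:R <= e.
  by rewrite ler_pdivrMr// mulrC -ler_pdivrMr.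
rewrite sub0r normrN ger0_norm /max_relative_error; last first.
  by rewrite bigmax_ge_id.
rewrite big_nat; apply: bigmax_le => [|s /andP[s1 ss]]; first exact: ltW.
apply: bigmax_le => [|H _]; first exact: ltW.
apply: le_trans le_e; apply: hA => //.
- have s_gt : (s <= Num.truncn (size_bound p delta (11 / ln (gamma p)) n))%N by [].
  apply: le_trans (_ : (Num.truncn (size_bound p delta (11 / ln (gamma p)) n))%:R <= _).
    by rewrite ler_nat.
  rewrite truncn_le; case: leP => // neg.
  by move: (leq_trans s1 s_gt); rewrite truncn_gt_nat; lra.
- by move=> v; apply: ltW; exact: hdeg.
- by move=> v v' vv'; apply: ltW; exact: hcodeg.
Qed.
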